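(* Let $A \in M_n(\mathbb{R})$ be a diagonalizable (entrywise) nonnegative matrix of rank $k$, and suppose $n \geq k+k^2$. Then there exists a diagonalizable (entrywise) nonnegative matrix $\tilde{A} \in M_{k+k^2}(\mathbb{R})$ whose nonzero spectrum is the same as the nonzero spectrum of $A$.
   Context: $M_n(\mathbb{R})$ denotes the set of $n\times n$ real matrices. A matrix is nonnegative if all its entries are nonnegative. Diagonalizable means diagonalizable over $\mathbb{C}$. The nonzero spectrum of a square matrix is the list (multiset) of its nonzero complex eigenvalues, counted with algebraic multiplicity. A matrix of order $0$ is the empty matrix, which is regarded as diagonalizable and nonnegative, with empty spectrum. *)

(* Defs.v *)
From mathcomp Require Import all_boot all_order all_algebra.
From mathcomp Require Import complex reals.

Set Implicit Arguments.
Unset Strict Implicit.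
Unset Printing Implicit Defensive.

Import Order.TTheory GRing.Theory Num.Theory.

Local Open Scope ring_scope.

Definition complexmx (R : realType) m n (A : 'M[R]_(m, n)) : 'M[R[i]]_(m, n) :=
  map_mx (real_complex R) A.

Definition nonnegmx (R : realType) m n (A : 'M[R]_(m, n)) : Prop :=
  forall i j, 0 <= A i j.

Definition Cdiagonalizable (R : realType) n (A : 'M[R]_n) : Prop :=
  diagonalizable (complexmx A).

(* The order of these lists is arbitrary: compare them with [perm_eq] only. *)
Definition spectrum (R : realType) n (A : 'M[R]_n) : seq R[i] :=
  sval (closed_field_poly_normal (char_poly (complexmx A))).

Definition nonzero_spectrum (R : realType) n (A : 'M[R]_n) : seq R[i] :=
  [seq z <- spectrum A | z != 0].

Lemma char_poly_spectrum (R : realType) n (A : 'M[R]_n) :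
  char_poly (complexmx A) = \prod_(z <- spectrum A) ('X - z%:P).
Proof.
rewrite /spectrum; case: closed_field_poly_normal => s /= {1}->.
by rewrite (eqP (char_poly_monic _)) scale1r.
Qed.

Lemma count_mem_spectrum (R : realType) n (A : 'M[R]_n) (z : R[i]) :
  count_mem z (spectrum A) = mup z (char_poly (complexmx A)).
Proof. by rewrite char_poly_spectrum mu_prod_XsubC. Qed.

(* Main.v *)
(** Write [A = U V] with [U] of full column rank [k] and [V] of full row rank
    [k].  The nonzero spectrum of [U V] is that of the [k x k] matrix [V U],
    and diagonalizability of [U V] also only depends on [V U].  Now
    [V U = \sum_j v_j u_j], with [v_j] the columns of [V] and [u_j] the rows of
    [U], is a sum of [n] vectors in a space of dimension [k^2], so by
    Caratheodory's theorem for cones [V U = \sum_j c_j v_j u_j] where [c >= 0]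
    has at most [k^2] nonzero entries.  The submatrix of [diag(c) A] on the
    support of [c], padded with zeros, is the wanted matrix. *)
Require Import Defs.
From mathcomp Require Import all_boot all_order all_algebra.
From mathcomp Require Import complex reals.

Set Implicit Arguments.
Unset Strict Implicit.
Unset Printing Implicit Defensive.

Import Order.TTheory GRing.Theory Num.Theory.

Local Open Scope ring_scope.

(** Induction on the size of the support of [c]: more than [d] rows of [W] satisfy a linear relation
    [y], and moving [c] along [y] until a coordinate vanishes shrinks the support. *)
Lemma conic_caratheodory (F : realFieldType) (n d : nat) (W : 'M[F]_(n, d))
    (c : 'rV[F]_n) :
  (forall j, 0 <= c 0 j) ->
  exists e : 'rV[F]_n,
    [/\ forall j, 0 <= e 0 j, e *m W = c *m W
      & (#|[set j | (e 0 j != 0)%R]| <= d)%N].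
Proof.
have [m] := ubnP #|[set j | (c 0 j != 0)%R]|.
elim: m c => // m IHm c; set S := [set j | _] => ltSm c_ge0.
have [leSd|ltdS] := leqP #|S| d; first by exists c.
have [y [y_neq0 yW0 yS]] : exists y : 'rV[F]_n,
    [/\ y != 0, y *m W = 0 & forall j, c 0 j = 0 -> y 0 j = 0].
  (* [P *m W] keeps the rows of [W] indexed by [S]; having more rows than columns, it has a nonzero
     left kernel vector [x], which [x *m P] extends by zero outside [S]. *)
  pose P : 'M[F]_(#|S|, n) := rowsub (@enum_val _ (mem S)) 1%:M.
  have : kermx (P *m W) != 0.
    by rewrite kermx_eq0 /row_free neq_ltn (leq_ltn_trans (rank_leq_col _)).
  case/rowV0Pn => x /sub_kermxP xPW0 x_neq0; exists (x *m P); split.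
  - apply: contraNneq x_neq0 => xP0; apply/eqP/rowP => i.
    have := congr1 (fun u : 'rV_n => u 0 (enum_val i)) xP0.
    rewrite !mxE (bigD1 i) //= !mxE eqxx mulr1 big1 ?addr0 // => l l_neq_i.
    by rewrite !mxE (inj_eq enum_val_inj) (negPf l_neq_i) mulr0.
  - by rewrite -mulmxA.
  - move=> j cj0; rewrite mxE big1 // => l _; rewrite !mxE.
    case: eqP => [lj|_]; last by rewrite mulr0.
    by have := enum_valP l; rewrite lj inE cj0 eqxx.
wlog [j0 yj0] : y y_neq0 yW0 yS / exists j, 0 < y 0 j.
  move=> IHy; have /rV0Pn[j yj] := y_neq0.
  have [yj_gt0|yj_lt0|/eqP] := ltgtP 0 (y 0 j); last by rewrite eq_sym (negPf yj).
  - by apply: (IHy y) => //; exists j.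
  - apply: (IHy (- y)); rewrite ?oppr_eq0 ?mulNmx ?yW0 ?oppr0 //.
      by move=> l cl0; rewrite mxE yS ?oppr0.
    by exists j; rewrite mxE oppr_gt0.
(* The smallest ratio over [0 < y 0 j] is the longest step keeping [c - t *: y] nonnegative;
   coordinate [j1] then vanishes. *)
pose ratio j := c 0 j / y 0 j.
case: (@Order.TotalTheory.arg_minP _ _ _ j0 (fun j => 0 < y 0 j) ratio yj0) => j1 yj1 min_j1.
have t_ge0 : 0 <= ratio j1 by rewrite divr_ge0 // ltW.
have [||e [e_ge0 eW ed]] := IHm (c - ratio j1 *: y); last 1 first.
- exists e; split=> //; rewrite eW mulmxBl -scalemxAl yW0 scaler0 subr0 //.
- rewrite -ltnS; apply: leq_trans ltSm; rewrite ltnS.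
  apply/proper_card/properP; split.
    apply/subsetP => j; rewrite !inE; apply: contraNneq => cj0.
    by rewrite !mxE cj0 yS // mulr0 subr0.
  exists j1; rewrite inE.
    by apply: contraTneq yj1 => /yS ->; rewrite ltxx.
  by rewrite negbK !mxE divfK ?lt0r_neq0 // subrr.
- move=> j; rewrite !mxE subr_ge0; have [yj|yj] := ltrP 0 (y 0 j).
    by rewrite -ler_pdivlMr // min_j1.
  by apply: le_trans (c_ge0 j); rewrite mulr_ge0_le0.
Qed.

(** Sending the support of [c] injectively into the [m] row indices gives a 0/1 matrix [P] with
    [P^T *m P] the coordinate projection onto that support. *)
Lemma selection_mx (F : realFieldType) (n m : nat) (c : 'rV[F]_n) :
  (#|[set j | (c 0 j != 0)%R]| <= m)%N ->
  exists P : 'M[F]_(m, n),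
    (forall i j, 0 <= P i j) /\ P^T *m P *m diag_mx c = diag_mx c.
Proof.
set S := [set j | _] => leSm.
exists (\matrix_(i, j) ((j \in S) && (index j (enum S) == i))%:R).
split=> [i j|]; first by rewrite mxE ler0n.
apply/matrixP => j l; rewrite mul_mx_diag !mxE.
have -> : c 0 j *+ (j == l) = c 0 l *+ (j == l) by case: eqP => // ->.
have [cl0|cl_neq0] := eqVneq (c 0 l) 0; first by rewrite cl0 mulr0 mul0rn.
have lS : l \in S by rewrite inE.
have ltlm : (index l (enum S) < m)%N.
  by apply: leq_trans leSm; rewrite cardE index_mem mem_enum.
rewrite (bigD1 (Ordinal ltlm)) //= !mxE lS eqxx mulr1 big1 => [|i i_neq].
  have [->|j_neq] := eqVneq j l; first by rewrite lS eqxx addr0 mul1r.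
  have [jS|_] := boolP (j \in S); last by rewrite mulr0n addr0 mul0r.
  have -> : index j (enum S) == index l (enum S) = false.
    apply: contra_neqF j_neq => /eqP eq_idx.
    by apply: (index_inj l _ _ eq_idx); rewrite mem_enum.
  by rewrite mulr0n addr0 mul0r.
rewrite !mxE lS [index l _ == _](_ : _ = false) ?mulr0 //.
by apply: contra_neqF i_neq => /eqP idx; apply/val_inj.
Qed.

(* Both determinants come from multiplying [block_mx 'X%:M U V 1%:M] by a
   block triangular matrix. *)
Lemma char_poly_mulmxC (R : comNzRingType) (n k : nat) (U : 'M[R]_(n, k))
    (V : 'M[R]_(k, n)) :
  char_poly (U *m V) * 'X^k = char_poly (V *m U) * 'X^n.
Proof.
pose u := map_mx polyC U; pose v := map_mx polyC V.
pose M := block_mx 'X%:M u v 1%:M.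
have <- : \det M = char_poly (U *m V).
  have := det_mulmx M (block_mx 1%:M 0 (- v) 1%:M).
  rewrite det_lblock !det1 !mulr1 => <-.
  rewrite mulmx_block !mulmx1 !mulmx0 !mul1mx !add0r subrr mulmxN.
  by rewrite det_ublock det1 mulr1 /char_poly /char_poly_mx map_mxM.
have := det_mulmx M (block_mx 1%:M (- u) 0 'X%:M).
rewrite det_ublock det1 mul1r det_scalar => <-.
rewrite mulmx_block !mulmx1 !mulmx0 !addr0 mul1mx !mulmxN scalar_mxC addNr.
by rewrite det_lblock det_scalar mulrC addrC /char_poly /char_poly_mx map_mxM.
Qed.

(** The two characteristic polynomials agree up to powers of ['X], which do not vanish at [z]. *)
Lemma mup_char_poly_mulmxC (F : fieldType) (n k : nat) (U : 'M[F]_(n, k))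
    (V : 'M[F]_(k, n)) (z : F) :
  z != 0 -> mup z (char_poly (U *m V)) = mup z (char_poly (V *m U)).
Proof.
move=> z_neq0; have NrootX m : ~~ root ('X^m : {poly F}) z.
  by rewrite /root hornerXn expf_neq0.
by rewrite -(mupMl _ (NrootX k)) char_poly_mulmxC mupMl.
Qed.

Lemma horner_mx_mulmxC (R : comNzRingType) (n k : nat) (U : 'M[R]_(n.+1, k.+1))
    (V : 'M[R]_(k.+1, n.+1)) (p : {poly R}) :
  horner_mx (U *m V) p *m U = U *m horner_mx (V *m U) p.
Proof.
elim/poly_ind: p => [|p a IHp]; first by rewrite !rmorph0 mul0mx mulmx0.
rewrite !rmorphD !rmorphM /= !horner_mx_X !horner_mx_C mulmxDl mulmxDr.
rewrite scalar_mxC; congr (_ + _); rewrite -!mulmxE !mulmxA.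
by rewrite IHp.
Qed.

(* For a split squarefree [q] with [q(0) != 0], ['X * q] kills [U *m V] iff
   [q] kills [V *m U]. *)
Lemma diagonalizable_mulmxC (F : fieldType) (n m k : nat) (U : 'M[F]_(n, k))
    (V : 'M[F]_(k, n)) (U' : 'M[F]_(m, k)) (V' : 'M[F]_(k, m)) :
  row_full U -> row_free V -> V' *m U' = V *m U ->
  diagonalizable (U *m V) -> diagonalizable (U' *m V').
Proof.
(* [horner_mx] requires matrices of positive order, so zero dimensions are treated apart. *)
case: k => [|k] in U V U' V' *.
  by move=> *; rewrite (thinmx0 U') mul0mx; apply: diagonalizable0.
case: m => [|m] in U' V' *.
  by move=> *; rewrite (flatmx0 U') mul0mx; apply: diagonalizable0.
case: n => [|n] in U V *.
  by rewrite /row_full => /eqP rU; have := rank_leq_row U; rewrite rU.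
move=> fullU freeV eqVU /diagonalizableP[rs uniq_rs min_rs].
(* Removing 0 from [rs] keeps [q * 'X] squarefree, whether or not 0 is in [rs]. *)
pose ps := [seq x <- rs | x != 0]; pose q := \prod_(x <- ps) ('X - x%:P).
have qX : q * 'X = \prod_(x <- 0 :: ps) ('X - x%:P).
  by rewrite big_cons subr0 mulrC.
have /mxminpoly_minP : mxminpoly (U *m V) %| q * 'X.
  rewrite qX; apply: dvdp_trans min_rs _; apply: uniq_roots_dvdp.
    apply/allP => x x_rs; rewrite root_prod_XsubC inE mem_filter x_rs andbT.
    exact: orbN.
  by rewrite uniq_rootsE.
rewrite rmorphM /= horner_mx_X -mulmxE mulmxA horner_mx_mulmxC -mulmxA => UqV0.
(* [UqV0] reads [U *m (q(V *m U) *m V) = 0]; the rank hypotheses cancel [U] on the left and [V] on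
   the right. *)
have qVU0 : horner_mx (V *m U) q = 0.
  apply: (row_free_inj freeV); apply: (row_full_inj fullU).
  by rewrite UqV0 mul0mx mulmx0.
apply/diagonalizableP; exists (0 :: ps).
  by rewrite /= mem_filter eqxx filter_uniq.
apply/mxminpoly_minP; rewrite -qX rmorphM /= horner_mx_X -mulmxE mulmxA.
by rewrite horner_mx_mulmxC eqVU qVU0 mulmx0 mul0mx.
Qed.

Theorem corollary2p2 (R : realType) (n k : nat) (A : 'M[R]_n) :
  Cdiagonalizable A ->
  nonnegmx A ->
  \rank A = k ->
  (k + k ^ 2 <= n)%N ->
  exists B : 'M[R]_(k + k ^ 2),
    [/\ Cdiagonalizable B, nonnegmx B
      & perm_eq (nonzero_spectrum B) (nonzero_spectrum A)].
Proof.
move=> diagA A_ge0 rkA _; subst k; move: (mulmx_base A).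
have := row_base_free A; have := col_base_full A.
move: (col_base A) (row_base A); set k := \rank A => U V fullU freeV defA.
pose W : 'M[R]_(n, k * k) := \matrix_j mxvec (\matrix_(a, b) (V a j * U j b)).
have mulW c : V *m diag_mx c *m U = vec_mx (c *m W).
  apply/matrixP => a b; rewrite mul_mx_diag !mxE; apply: eq_bigr => j _.
  by rewrite !mxE mxvecE !mxE mulrAC mulrA mulrC mulrA.
(* All weights equal to 1 give [V *m U] itself. *)
have [|c [c_ge0 cW supp_c]] := @conic_caratheodory _ _ _ W (const_mx 1).
  by move=> j; rewrite mxE ler01.
have VcU : V *m diag_mx c *m U = V *m U.
  by rewrite mulW cW -mulW diag_const_mx mulmx1.
have [|P [P_ge0 PPc]] := @selection_mx _ _ (k + k ^ 2) c.
  by apply: leq_trans supp_c _; rewrite mulnn leq_addl.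
pose U' := P *m diag_mx c *m U; pose V' := V *m P^T.
have VU' : V' *m U' = V *m U.
  by rewrite -VcU -PPc /V' /U' !mulmxA.
have mapM := @map_mxM _ _ (real_complex R).
have VUC : complexmx V' *m complexmx U' = complexmx V *m complexmx U.
  by rewrite -!mapM VU'.
exists (U' *m V'); split.
- rewrite /Cdiagonalizable /complexmx mapM.
  apply: (diagonalizable_mulmxC (U := complexmx U) (V := complexmx V)).
  + by rewrite /complexmx row_full_map.
  + by rewrite /complexmx row_free_map.
  + exact: VUC.
  + by rewrite -mapM defA.
- have mul_ge0 a b d (X : 'M[R]_(a, b)) (Y : 'M[R]_(b, d)) :
      nonnegmx X -> nonnegmx Y -> nonnegmx (X *m Y).
    by move=> X0 Y0 i j; rewrite mxE sumr_ge0 // => l _; rewrite mulr_ge0.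
  (* [U] and [V] may have negative entries; regrouping them into [A] leaves only nonnegative
     factors. *)
  have -> : U' *m V' = P *m diag_mx c *m A *m P^T.
    by rewrite -defA /U' /V' !mulmxA.
  have c_nonneg : nonnegmx (diag_mx c) by move=> i j; rewrite mxE mulrn_wge0.
  have PT_nonneg : nonnegmx P^T by move=> i j; rewrite mxE.
  by do 3![apply: (mul_ge0) => //].
- apply/allP => z _ /=; rewrite /nonzero_spectrum !count_filter.
  (* Filtering leaves no 0 in either list; for other [z] the multiplicity passes from [U' *m V'] to
     [V' *m U' = V *m U], then to [U *m V]. *)
  have [->|z_neq0] := eqVneq z 0.
    by rewrite !(@eq_count _ _ pred0) ?count_pred0 // => x /=; case: eqP.
  rewrite !(@eq_count _ _ (pred1 z)).
  + rewrite !count_mem_spectrum /complexmx -[in X in _ == X]defA.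
    rewrite (mapM _ _ _ U' V') (mapM _ _ _ U V) mup_char_poly_mulmxC // VUC.
    by rewrite mup_char_poly_mulmxC.
  + by move=> x /=; case: eqP => // ->.
  + by move=> x /=; case: eqP => // ->.
Qed.
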